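(* Let $(G,\Lambda)$ be a self-similar $k$-graph over a finitely aligned $k$-graph $\Lambda$. Then the tight groupoid $\mathcal{G}_{\mathrm{tight}}(\mathcal{S}_{G,\Lambda})$ is Hausdorff if and only if $\mathbf{SF}_g$ is locally exhausted for all $g\in G\setminus\{e_G\}$.
   Context: **$k$-graphs.** A $k$-graph is a countable small category $\Lambda$ with a functor $d:\Lambda\to\mathbb{N}^k$ (degree) with the unique factorisation property: if $d(\lambda)=m+n$ there are unique $\mu,\nu$ with $d(\mu)=m$, $d(\nu)=n$, $\lambda=\mu\nu$. $\Lambda^0=d^{-1}(0)$ is identified with the objects (vertices); $r,s$ are range and source, and $\mu\nu$ is defined iff $s(\mu)=r(\nu)$. With $\vee$ the coordinatewise maximum, $\Lambda^{\min}(\mu,\nu)=\{(\alpha,\beta):\mu\alpha=\nu\beta,\ d(\mu\alpha)=d(\mu)\vee d(\nu)\}$. $\Lambda$ is finitely aligned if all $\Lambda^{\min}(\mu,\nu)$ are finite. **Self-similar $k$-graph** $(G,\Lambda)=(G,\Lambda,\varphi)$: a finitely aligned $k$-graph $\Lambda$, a countable discrete group $G$ with identity $e_G$, an action of $G$ on $\Lambda$ by degree-preserving bijections commuting with $r$ and $s$, and a map $\varphi:G\times\Lambda\to G$ such that for all $g,h\in G$, $\mu,\nu\in\Lambda$ (with $s(\mu)=r(\nu)$ where $\mu\nu$ occurs), $v\in\Lambda^0$: $\varphi(gh,\mu)=\varphi(g,h\cdot\mu)\varphi(h,\mu)$; $g\cdot(\mu\nu)=(g\cdot\mu)(\varphi(g,\mu)\cdot\nu)$;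 $\varphi(g,\mu\nu)=\varphi(\varphi(g,\mu),\nu)$; $\varphi(g,v)=g$. **Strongly fixed paths.** For $g\in G$, $\mathbf{SF}_g=\{\tau\in\Lambda: g\cdot\tau=\tau\text{ and }\varphi(g,\tau)=e_G\}$, and $v\mathbf{SF}_g=\{\tau\in\mathbf{SF}_g:r(\tau)=v\}$. $\mathbf{SF}_g$ is locally exhausted if for every $v\in\Lambda^0$ there is a finite set $\mathcal{M}\subseteq v\mathbf{SF}_g$ such that for every $\tau\in v\mathbf{SF}_g$ there is $\tau'\in\mathcal{M}$ with $\Lambda^{\min}(\tau,\tau')\neq\emptyset$. **$\mathcal{S}_{G,\Lambda}$**: elements are the finite sets $F$ of triples $(\mu,g,\nu)\in\Lambda\times G\times\Lambda$ with $s(\mu)=g\cdot s(\nu)$, such that any two distinct triples $(\mu,g,\nu),(\xi,h,\eta)\in F$ are orthogonal, i.e. $\Lambda^{\min}(\mu,\xi)=\Lambda^{\min}(\nu,\eta)=\emptyset$. Multiplication: $EF=\bigcup_{(\mu,g,\nu)\in E,(\xi,h,\eta)\in F}\{(\mu(g\cdot\alpha),\varphi(g,\alpha)\varphi(h,h^{-1}\cdot\beta),\eta(h^{-1}\cdot\beta)):(\alpha,\beta)\in\Lambda^{\min}(\nu,\xi)\}$; $F^*=\{(\nu,g^{-1},\mu):(\mu,g,\nu)\in F\}$; zero is $\emptyset$. It is an inverse semigroup with zero. **Tight groupoid.** Let $S$ be an inverse semigroup with $0$, $\mathcal{E}(S)$ its idempotent semilattice with order $e\le f\iff ef=e$. A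 filter is a nonempty subset of $\mathcal{E}(S)$ closed under products and upward closed; $\widehat{\mathcal{E}}_0(S)$ is the set of filters not containing $0$, topologised by the sets $\{\mathcal{F}:e\in\mathcal{F},e_1,\dots,e_n\notin\mathcal{F}\}$. Ultrafilters are the maximal elements of $\widehat{\mathcal{E}}_0(S)$; the tight spectrum $\widehat{\mathcal{E}}_{\mathrm{tight}}(S)$ is the closure of the set of ultrafilters in $\widehat{\mathcal{E}}_0(S)$. $S$ acts on it: for $s\in S$, $\theta_s$ is defined on the tight filters containing $s^*s$ by $\theta_s(\mathcal{F})=\{f\in\mathcal{E}(S):f\ge ses^*\text{ for some }e\in\mathcal{F}\}$. $\mathcal{G}_{\mathrm{tight}}(S)$ is the groupoid of germs $[s,\mathcal{F}]$ ($s^*s\in\mathcal{F}$), with $[s,\mathcal{F}]=[t,\mathcal{F}']$ iff $\mathcal{F}=\mathcal{F}'$ and $se=te$ for some $e\in\mathcal{F}$; $[t,\theta_s(\mathcal{F})][s,\mathcal{F}]=[ts,\mathcal{F}]$, $[s,\mathcal{F}]^{-1}=[s^*,\theta_s(\mathcal{F})]$; topology generated by the sets $\{[s,\mathcal{F}]:\mathcal{F}\in U\}$, with $s\in S$ and $U$ open in the domain of $\theta_s$. *)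

(* Defs.v *)
From HB Require Import structures.
From mathcomp Require Import all_boot all_algebra.
From mathcomp Require Import all_classical.
From mathcomp.analysis.topology_theory Require Import topology.

Set Implicit Arguments.
Unset Strict Implicit.
Unset Printing Implicit Defensive.

Import GRing.Theory.
Local Open Scope group_scope.
Local Open Scope classical_set_scope.

(** Arrows-only presentation of a small category: [rng x] and [src x] are the
    identity arrows at the range and the source of [x]; by unique
    factorisation the identity arrows are exactly the arrows of degree 0.  [cmp] is total; its
    value is meaningful only when [src x = rng y], hence the guards below. *)
Record kgraph (k : nat) := KGraph {
  arr :> choiceType;
  arr_countable : countable [set: arr];
  rng : arr -> arr;
  src : arr -> arr;
  cmp : arr -> arr -> arr;
  deg : arr -> {ffun 'I_k -> nat};
  rng_rng : forall x, rng (rng x) = rng x;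
  src_rng : forall x, src (rng x) = rng x;
  rng_src : forall x, rng (src x) = src x;
  src_src : forall x, src (src x) = src x;
  rng_cmp : forall x y, src x = rng y -> rng (cmp x y) = rng x;
  src_cmp : forall x y, src x = rng y -> src (cmp x y) = src y;
  cmp_rng : forall x, cmp (rng x) x = x;
  cmp_src : forall x, cmp x (src x) = x;
  cmpA : forall x y z, src x = rng y -> src y = rng z ->
    cmp x (cmp y z) = cmp (cmp x y) z;
  deg_rng : forall x, deg (rng x) = 0%R;
  deg_cmp : forall x y, src x = rng y -> deg (cmp x y) = (deg x + deg y)%R;
  factorisation : forall x m n, deg x = (m + n)%R ->
    exists! p : arr * arr,
      [/\ src p.1 = rng p.2, deg p.1 = m, deg p.2 = n & x = cmp p.1 p.2]
}.

Arguments rng {k _} _.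
Arguments src {k _} _.
Arguments cmp {k _} _ _.
Arguments deg {k _} _.

Local Notation "x ** y" := (cmp x y) (at level 40, left associativity).

Section KGraph.
Context {k : nat} {L : kgraph k}.
Implicit Types x y z mu nu : L.

Definition vertices : set L := [set v | deg v = 0%R].

Definition deg_join (m n : {ffun 'I_k -> nat}) : {ffun 'I_k -> nat} :=
  [ffun i => maxn (m i) (n i)].

Definition Lmin mu nu : set (L * L) :=
  [set p | [/\ src mu = rng p.1, src nu = rng p.2, mu ** p.1 = nu ** p.2
             & deg (mu ** p.1) = deg_join (deg mu) (deg nu)]].

Lemma degI (m n n' : {ffun 'I_k -> nat}) : (m + n = m + n')%R -> n = n'.
Proof.
move=> e; apply/ffunP => i; have := congr1 (fun f : {ffun _} => f i) e.
by rewrite !ffunE => /addnI.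
Qed.

Lemma factor_uniq x y x' y' : src x = rng y -> src x' = rng y' ->
  deg x = deg x' -> x ** y = x' ** y' -> x = x' /\ y = y'.
Proof.
move=> cxy cxy' dx e.
have dy : deg y = deg y' by apply: (@degI (deg x)); rewrite {2}dx -!deg_cmp// e.
have [p [_ pu]] := factorisation (deg_cmp cxy).
have /(etrans (esym _)) := pu (x, y) (And4 cxy erefl erefl erefl).
by move=> /(_ _ (pu (x', y') (And4 cxy' (esym dx) (esym dy) e))) [].
Qed.

Lemma cmpI x y y' : src x = rng y -> src x = rng y' -> x ** y = x ** y' ->
  y = y'.
Proof. by move=> h h' e; have [] := factor_uniq h h' erefl e. Qed.

Lemma deg_src x : deg (src x) = 0%R.
Proof. by rewrite -rng_src deg_rng. Qed.

Lemma vertexP x : deg x = 0%R -> rng x = x /\ src x = x.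
Proof.
move=> d0; have [] := @factor_uniq (rng x) x x (src x).
- by rewrite src_rng.
- by rewrite rng_src.
- by rewrite d0 deg_rng.
- by rewrite cmp_rng cmp_src.
by [].
Qed.

Lemma factor_le x (m : {ffun 'I_k -> nat}) : (forall i, m i <= deg x i)%N ->
  exists y z, [/\ src y = rng z, deg y = m & x = y ** z].
Proof.
move=> le; have [|[y z] [[/= h dy _ e] _]] :=
  @factorisation k L x m [ffun i => (deg x i - m i)%N].
  by apply/ffunP => i; rewrite !ffunE; exact: esym (subnKC (le i)).
by exists y, z.
Qed.

Lemma Lmin_factor mu nu a b :
  src mu = rng a -> src nu = rng b -> mu ** a = nu ** b ->
  exists al be t, [/\ Lmin mu nu (al, be), src al = rng t, src be = rng t,
    a = al ** t & b = be ** t].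
Proof.
move=> ca cb e; set x := mu ** a.
have dx1 : deg x = (deg mu + deg a)%R by rewrite deg_cmp.
have dx2 : deg x = (deg nu + deg b)%R by rewrite /x e deg_cmp.
have [|rho [t [crt drho ex]]] := @factor_le x (deg_join (deg mu) (deg nu)).
  move=> i; rewrite ffunE geq_max; apply/andP.
  by split; [rewrite dx1|rewrite dx2]; rewrite ffunE; exact: leq_addr.
have [|mu' [al [cmal dmu' erho]]] := @factor_le rho (deg mu).
  by move=> i; rewrite drho ffunE leq_maxl.
have [|nu' [be [cnbe dnu' erho']]] := @factor_le rho (deg nu).
  by move=> i; rewrite drho ffunE leq_maxr.
have calt : src al = rng t by rewrite -crt erho src_cmp.
have cbet : src be = rng t by rewrite -crt erho' src_cmp.
have [||emu ea] := @factor_uniq mu a mu' (al ** t) ca _ (esym dmu').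
- by rewrite rng_cmp.
- by rewrite cmpA// -erho -ex.
have [||enu eb] := @factor_uniq nu b nu' (be ** t) cb _ (esym dnu').
- by rewrite rng_cmp.
- by rewrite cmpA// -erho' -ex -e.
subst mu' nu'; exists al, be, t; split => //; split => //=.
- by rewrite -erho -erho'.
- by rewrite -erho.
Qed.

Lemma Lmin_deg_uniq mu nu al be al' be' :
  Lmin mu nu (al, be) -> Lmin mu nu (al', be') ->
  deg al = deg al' /\ deg be = deg be'.
Proof.
move=> -[/= c1 c2 e d] [/= c1' c2' e' d'].
have ed := etrans d (esym d'); have ed2 := ed; rewrite e e' in ed2.
rewrite !deg_cmp// in ed; rewrite !deg_cmp// in ed2.
by split; [exact: degI ed|exact: degI ed2].
Qed.

End KGraph.

Definition locally_exhausted (k : nat) (L : kgraph k) (A : set L) :=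
  forall v : L, vertices v ->
    exists M : set L, [/\ finite_set M, M `<=` A `&` [set t | rng t = v] &
      forall t, A t -> rng t = v -> exists2 t', M t' & Lmin t t' !=set0].

Definition finitely_aligned (k : nat) (L : kgraph k) :=
  forall mu nu : L, finite_set (Lmin mu nu).

Record self_similar (k : nat) (G : groupType) (L : kgraph k) := SelfSimilar {
  ss_aligned : finitely_aligned L;
  ss_countable : countable [set: G];
  act : G -> L -> L;
  coc : G -> L -> G;
  act1 : forall x, act 1 x = x;
  actM : forall g h x, act (g * h) x = act g (act h x);
  deg_act : forall g x, deg (act g x) = deg x;
  rng_act : forall g x, rng (act g x) = act g (rng x);
  src_act : forall g x, src (act g x) = act g (src x);
  cocM : forall g h x, coc (g * h) x = coc g (act h x) * coc h x;
  (* composability of the right-hand side of [act_cmp]; it is not automatic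
     because [cmp] is total *)
  act_composable : forall g x y, src x = rng y ->
    src (act g x) = rng (act (coc g x) y);
  act_cmp : forall g x y, src x = rng y ->
    act g (x ** y) = act g x ** act (coc g x) y;
  coc_cmp : forall g x y, src x = rng y ->
    coc g (x ** y) = coc (coc g x) y;
  coc_vertex : forall g v, vertices v -> coc g v = g
}.

Section SelfSimilar.
Context {k : nat} {G : groupType} {L : kgraph k} (X : self_similar G L).
Implicit Types (g h : G) (x y mu nu v : L).

Local Notation "g .* x" := (act X g x) (at level 30, right associativity).
Local Notation phi := (coc X).

Definition strongly_fixed g : set L := [set t | g .* t = t /\ phi g t = 1].

(** A triple [(mu, g, nu)] is encoded as [((mu, g), nu)]. *)
Definition triple : Type := L * G * L.
Implicit Types (t u : triple) (E F : set triple).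

Definition orthogonal t u := Lmin t.1.1 u.1.1 = set0 /\ Lmin t.2 u.2 = set0.

Definition SGL_elt F := [/\ finite_set F,
  forall t, F t -> src t.1.1 = t.1.2 .* src t.2 &
  forall t u, F t -> F u -> t <> u -> orthogonal t u].

Definition SGL_mul E F : set triple :=
  [set w | exists mu g nu xi h eta al be,
    [/\ E (mu, g, nu), F (xi, h, eta), Lmin nu xi (al, be) &
      w = (mu ** (g .* al), phi g al * phi h (h^-1 .* be),
           eta ** (h^-1 .* be))]].

Definition SGL_star F : set triple :=
  [set (t.2, t.1.2^-1, t.1.1) | t in F].

Lemma actK g x : g^-1 .* (g .* x) = x.
Proof. by rewrite -actM mulVg act1. Qed.

Lemma actVK g x : g .* (g^-1 .* x) = x.
Proof. by rewrite -actM mulgV act1. Qed.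

Lemma coc1 x : phi 1 x = 1.
Proof.
by apply: (mulgI (phi 1 x)); rewrite mulg1 -{1}(act1 X x) -cocM mulg1.
Qed.

Lemma cocV g x : phi g^-1 (g .* x) = (phi g x)^-1.
Proof. by apply: (mulIg (phi g x)); rewrite -cocM !mulVg coc1. Qed.

Lemma act_coc_src g x : phi g x .* src x = g .* src x.
Proof.
have := @act_composable _ _ _ X g x (src x) (esym (rng_src x)).
by rewrite rng_act rng_src src_act => ->.
Qed.

(** [ext t a] extends the partial bijection given by the triple [t] along [a];
    [up F] is the set of all extensions of elements of [F]. *)
Definition ext t x : triple :=
  (t.1.1 ** (t.1.2 .* x), phi t.1.2 x, t.2 ** x).

Definition composable t := src t.1.1 = t.1.2 .* src t.2.

Definition up F : set triple :=
  [set w | exists t x, [/\ F t, src t.2 = rng x & w = ext t x]].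

Lemma comp_l t x : composable t -> src t.2 = rng x -> src t.1.1 = rng (t.1.2 .* x).
Proof. by rewrite /composable rng_act => -> ->. Qed.

Lemma ext_id t : composable t -> ext t (src t.2) = t.
Proof.
case: t => [[mu g] nu]; rewrite /composable /ext/= => e.
by rewrite -e !cmp_src coc_vertex//; exact: deg_src.
Qed.

Lemma ext_ext t x y : composable t -> src t.2 = rng x -> src x = rng y ->
  ext (ext t x) y = ext t (x ** y).
Proof.
move=> c cx cy; have := comp_l c cx.
case: t c cx => [[mu g] nu]; rewrite /composable /ext/= => c cx e.
rewrite act_cmp// coc_cmp// !cmpA//.
exact: act_composable.
Qed.

Lemma comp_ext t x : composable t -> src t.2 = rng x -> composable (ext t x).
Proof.
move=> c cx; have := comp_l c cx.
rewrite /composable/= => e; rewrite !src_cmp// act_coc_src src_act//.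
Qed.

Lemma ext_l F t t' x x' : SGL_elt F -> F t -> F t' ->
  src t.2 = rng x -> src t'.2 = rng x' ->
  (ext t x).1.1 = (ext t' x').1.1 -> t = t' /\ x = x'.
Proof.
move=> [_ C O] Ft Ft' cx cx' /= e.
have [c c'] := (comp_l (C _ Ft) cx, comp_l (C _ Ft') cx').
have [tt'|ne] := pselect (t = t'); last first.
  have [+ _] := O _ _ Ft Ft' ne.
  have [al [be [? [+ _ _ _ _]]]] := Lmin_factor c c' e.
  by move=> + /seteqP[/(_ (al, be)) + _] => /[swap]/[apply].
subst t'; split=> //; have /(congr1 (act X t.1.2^-1)) := cmpI c c' e.
by rewrite !actK.
Qed.

Lemma ext_r F t t' x x' : SGL_elt F -> F t -> F t' ->
  src t.2 = rng x -> src t'.2 = rng x' ->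
  (ext t x).2 = (ext t' x').2 -> t = t' /\ x = x'.
Proof.
move=> [_ C O] Ft Ft' c c' /= e.
have [tt'|ne] := pselect (t = t'); last first.
  have [_ +] := O _ _ Ft Ft' ne.
  have [al [be [? [+ _ _ _ _]]]] := Lmin_factor c c' e.
  by move=> + /seteqP[/(_ (al, be)) + _] => /[swap]/[apply].
by subst t'; split=> //; exact: cmpI c c' e.
Qed.

Lemma up_l F t t' : SGL_elt F -> up F t -> up F t' -> t.1.1 = t'.1.1 -> t = t'.
Proof.
move=> SF [u [x [Fu cx ->]]] [u' [x' [Fu' cx' ->]]] e.
by have [-> ->] := ext_l SF Fu Fu' cx cx' e.
Qed.

Lemma up_r F t t' : SGL_elt F -> up F t -> up F t' -> t.2 = t'.2 -> t = t'.
Proof.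
move=> SF [u [x [Fu cx ->]]] [u' [x' [Fu' cx' ->]]] e.
by have [-> ->] := ext_r SF Fu Fu' cx cx' e.
Qed.

Lemma sub_up F : SGL_elt F -> F `<=` up F.
Proof.
move=> [_ C _] t Ft; exists t, (src t.2); rewrite rng_src.
by split=> //; rewrite ext_id//; exact: C.
Qed.

Lemma up_comp F t : SGL_elt F -> up F t -> composable t.
Proof. by move=> [_ C _] [u [x [Fu cx ->]]]; apply: comp_ext => //; exact: C. Qed.

Lemma up_sub E F : SGL_elt E -> SGL_elt F -> up E = up F -> E `<=` F.
Proof.
move=> SE SF e t Et.
have : up F t by rewrite -e; exact: sub_up.
move=> [u [x [Fu cx et]]].
have : up E u by rewrite e; exact: sub_up.
move=> [t' [y [Et' cy eu]]].
have cu : composable u by case: SF => _ + _; exact.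
have ct' : composable t' by case: SE => _ + _; exact.
have ct : composable t by case: SE => _ + _; exact.
have cyx : src y = rng x by rewrite -cx eu /= src_cmp.
have cs : src t'.2 = rng (y ** x) by rewrite rng_cmp.
have et' : ext t (src t.2) = ext t' (y ** x) by rewrite ext_id// et eu ext_ext.
have [tt' sx] := ext_r SE Et Et' (esym (rng_src _)) cs (congr1 snd et').
have x0 : deg x = 0%R.
  have := congr1 deg sx; rewrite deg_src deg_cmp// => d0.
  apply/ffunP => i; have := congr1 (fun f : {ffun 'I_k -> nat} => f i) d0.
  rewrite !ffunE => /esym/eqP.
  by rewrite (_ : (_ + _)%R = (deg y i + deg x i)%N)// addn_eq0 => /andP[_ /eqP].
have [rx _] := vertexP x0.
by rewrite et -rx -cx ext_id.
Qed.

Lemma up_inj E F : SGL_elt E -> SGL_elt F -> up E = up F -> E = F.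
Proof. by move=> SE SF e; apply/seteqP; split; apply: up_sub. Qed.

(** Product of two sets of triples as partial bijections. *)
Definition gmul E F : set triple :=
  [set t | exists g h y, [/\ E (t.1.1, g, y), F (y, h, t.2) & t.1.2 = g * h]].

Lemma gmulA D E F : gmul D (gmul E F) = gmul (gmul D E) F.
Proof.
apply/seteqP; split => -[[x g] z] /=.
  move=> [a [b [y [Da [/= c [d [y' [Ec Fd ->]]]] ->]]]].
  by exists (a * c), d, y'; rewrite mulgA; split => //; exists a, c, y.
move=> [a [b [y [[/= c [d [y' [Dc Ed ->]]]] Fb ->]]]].
by exists c, (d * b), y'; rewrite mulgA; split => //; exists d, b, y.
Qed.

Lemma gmul_l E F : SGL_elt E -> SGL_elt F -> forall t t',
  gmul (up E) (up F) t -> gmul (up E) (up F) t' -> t.1.1 = t'.1.1 -> t = t'.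
Proof.
move=> SE SF [[x g] z] [[x' g'] z'] /= [a [b [y [/= Ea Fb ->]]]].
move=> [a' [b' [y' [/= Ea' Fb' ->]]]] e; subst x'.
have [ea ey] : (a, y) = (a', y') by have [-> ->] := up_l SE Ea Ea' erefl.
by subst a' y'; have [-> ->] := up_l SF Fb Fb' erefl.
Qed.

Lemma gmul_r E F : SGL_elt E -> SGL_elt F -> forall t t',
  gmul (up E) (up F) t -> gmul (up E) (up F) t' -> t.2 = t'.2 -> t = t'.
Proof.
move=> SE SF [[x g] z] [[x' g'] z'] /= [a [b [y [/= Ea Fb ->]]]].
move=> [a' [b' [y' [/= Ea' Fb' ->]]]] e; subst z'.
have [ey eb] : (y, b) = (y', b') by have [-> ->] := up_r SF Fb Fb' erefl.
by subst b' y'; have [-> ->] := up_r SE Ea Ea' erefl.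
Qed.

(** The triple contributed to a product by [t], [u] and
    [(al, t.1.2 .* ga)] in [Lmin]. *)
Definition pmul t u al ga : triple :=
  (t.1.1 ** (t.1.2 .* al), phi t.1.2 al * phi u.1.2 ga, u.2 ** ga).

Lemma SGL_mulP E F w : SGL_mul E F w <-> exists t u al ga,
  [/\ E t, F u, Lmin t.2 u.1.1 (al, u.1.2 .* ga) & w = pmul t u al ga].
Proof.
split=> [[mu [g [nu [xi [h [eta [al [be [Et Fu m ->]]]]]]]]]|].
  exists (mu, g, nu), (xi, h, eta), al, (h^-1 .* be).
  by split=> //=; rewrite actVK.
move=> [[[mu g] nu] [[[xi h] eta] [al [ga [Et Fu m ->]]]]].
by exists mu, g, nu, xi, h, eta, al, (h .* ga); rewrite actK.
Qed.

Lemma ext_pmul t u al ga x : composable t -> composable u ->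
    Lmin t.2 u.1.1 (al, u.1.2 .* ga) -> src ga = rng x ->
  let al' := al ** (phi u.1.2 ga .* x) in let ga' := ga ** x in
  let p := ext t al' in let q := ext u ga' in
  [/\ src t.2 = rng al', src u.2 = rng ga', p.2 = q.1.1 &
      ext (pmul t u al ga) x = (p.1.1, p.1.2 * q.1.2, q.2)].
Proof.
case: t => [[mu g] nu]; case: u => [[xi h] eta].
move=> c d [/= e1 e2 e3 e4] e5.
have f1 : src mu = rng (g .* al) by exact: comp_l c e1.
have f2 : src eta = rng ga.
  by have := congr1 (act X h^-1) (etrans (esym d) e2); rewrite rng_act !actK.
have f3 : src (h .* ga) = rng (phi h ga .* x) by exact: act_composable.
have f4 : src al = rng (phi h ga .* x).
  by rewrite -f3 -(src_cmp e1) e3 src_cmp.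
have f5 : src (g .* al) = rng (phi g al .* (phi h ga .* x)).
  by exact: act_composable.
rewrite /ext /pmul/=; split.
- by rewrite rng_cmp.
- by rewrite rng_cmp.
- by rewrite cmpA// e3 act_cmp// cmpA.
by rewrite act_cmp// !cmpA// !coc_cmp// -cocM actM.
Qed.

Lemma up_mul E F : SGL_elt E -> SGL_elt F ->
  up (SGL_mul E F) = gmul (up E) (up F).
Proof.
move=> [_ CE _] [_ CF _]; apply/seteqP; split => [w|[[x gh] z]].
  move=> [_ [x [/SGL_mulP[t [u [al [ga [Et Fu m ->]]]]] cx ->]]].
  have cga : src ga = rng x.
    rewrite -cx /= src_cmp//; case: m => /= _ + _ _.
    rewrite [src _]CF// rng_act => /(congr1 (act X u.1.2^-1)).
    by rewrite !actK.
  have [h1 h2 h3 ->] := ext_pmul (CE _ Et) (CF _ Fu) m cga.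
  exists (ext t (al ** (phi u.1.2 ga .* x))).1.2, (ext u (ga ** x)).1.2.
  exists (ext u (ga ** x)).1.1; split=> //.
    exists t, (al ** (phi u.1.2 ga .* x)); split=> //.
    by congr pair; exact: esym h3.
  by exists u, (ga ** x).
move=> /= [g [h [y [[t [a [Et ca /= et]]] [u [b [Fu cb eu]]] /= ->]]]].
have e : t.2 ** a = u.1.1 ** (u.1.2 .* b).
  by have := congr1 snd et; have := congr1 (fun w => w.1.1) eu => /= <- <-.
have [al [be [s [m c1 c2 ea eb]]]] := Lmin_factor ca (comp_l (CF _ Fu) cb) e.
pose ga := u.1.2^-1 .* be; pose r := phi u.1.2^-1 be .* s.
have ebe : u.1.2 .* ga = be by rewrite actVK.
have ebs : b = ga ** r by rewrite -(actK u.1.2 b) eb act_cmp.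
have es : s = phi u.1.2 ga .* r.
  by rewrite /r -actM -cocM mulgV coc1 act1.
have cga : src ga = rng r by exact: act_composable.
rewrite -ebe in m.
have [h1 h2 h3] := ext_pmul (CE _ Et) (CF _ Fu) m cga.
rewrite -es -ea -ebs => h4.
exists (pmul t u al ga), r; split.
- by apply/SGL_mulP; exists t, u, al, ga.
- rewrite /= src_cmp//; move: cb; rewrite ebs rng_cmp//.
by rewrite h4 -et -eu.
Qed.

Lemma SGL_mul_elt E F : SGL_elt E -> SGL_elt F -> SGL_elt (SGL_mul E F).
Proof.
move=> SE SF; have [finE CE OE] := SE; have [finF CF OF] := SF.
have CEF t : SGL_mul E F t -> composable t.
  move=> /SGL_mulP[{}t [u [al [ga [Et Fu [/= e1 e2 e3 e4] ->]]]]].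
  rewrite /composable /pmul/=.
  have f1 : src t.1.1 = rng (t.1.2 .* al) by exact: comp_l (CE _ Et) e1.
  have f2 : src u.2 = rng ga.
    have := congr1 (act X u.1.2^-1) (etrans (esym (CF _ Fu)) e2).
    by rewrite rng_act !actK.
  rewrite !src_cmp// actM act_coc_src -src_act -(src_cmp e2) -e3 src_cmp//.
  by rewrite act_coc_src src_act.
have key w w' : SGL_mul E F w -> SGL_mul E F w' -> forall a a',
    src w.2 = rng a -> src w'.2 = rng a' -> ext w a = ext w' a' -> w = w'.
  move=> /SGL_mulP[t [u [al [ga [Et Fu m ew]]]]].
  move=> /SGL_mulP[t' [u' [al' [ga' [Et' Fu' m' ew']]]]] a a' ca ca'.
  have f u0 ga0 al0 t0 w0 a0 : F u0 -> Lmin t0.2 u0.1.1 (al0, u0.1.2 .* ga0) ->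
      w0 = pmul t0 u0 al0 ga0 -> src w0.2 = rng a0 ->
      src u0.2 = rng ga0 /\ src ga0 = rng a0.
    move=> Fu0 [/= _ e2 _ _] ->.
    have f2 : src u0.2 = rng ga0.
      have := congr1 (act X u0.1.2^-1) (etrans (esym (CF _ Fu0)) e2).
      by rewrite rng_act !actK.
    by rewrite /= src_cmp.
  have [f1 f2] := f _ _ _ _ _ _ Fu m ew ca.
  have [f1' f2'] := f _ _ _ _ _ _ Fu' m' ew' ca'.
  have [h1 h2 h3 h4] := ext_pmul (CE _ Et) (CF _ Fu) m f2.
  have [h1' h2' h3' h4'] := ext_pmul (CE _ Et') (CF _ Fu') m' f2'.
  rewrite ew ew' h4 h4' => -[l _ r].
  have [tt' ela] := ext_l SE Et Et' h1 h1' l.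
  have [uu' ega] := ext_r SF Fu Fu' h2 h2' r.
  subst t' u'.
  have [d1 d2] := Lmin_deg_uniq m m'.
  rewrite !deg_act in d2.
  have [-> eaa] := factor_uniq f2 f2' d2 ega.
  suff -> : al = al' by [].
  have [c1 c2 e3 _] := m; have [c1' c2' e3' _] := m'.
  have g1 : src al = rng (phi u.1.2 ga .* a).
    by rewrite -act_composable//= -(src_cmp c1) [in LHS]e3 src_cmp.
  have g1' : src al' = rng (phi u.1.2 ga' .* a').
    by rewrite -act_composable//= -(src_cmp c1') [in LHS]e3' src_cmp.
  by have [] := factor_uniq g1 g1' d1 ela.
split=> //.
- apply: (@sub_finite_set _ _ (\bigcup_(p in E `*` F)
    [set pmul p.1 p.2 q.1 (p.2.1.2^-1 .* q.2) | q in Lmin p.1.2 p.2.1.1])).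
    move=> w /SGL_mulP[t [u [al [ga [Et Fu m ->]]]]].
    exists (t, u) => //; exists (al, u.1.2 .* ga) => //=.
    by rewrite actK.
  apply: bigcup_finite; first exact: finite_setX.
  by move=> p _; apply: finite_image; exact: (ss_aligned X).
- move=> t u EFt EFu ne; split; rewrite -subset0 => -[a b] /= [/= c1 c2 e _].
    apply: ne; pose a' := t.1.2^-1 .* a; pose b' := u.1.2^-1 .* b.
    have ca : src t.2 = rng a'.
      have := congr1 (act X t.1.2^-1) (etrans (esym (CEF _ EFt)) c1).
      by rewrite actK /a' rng_act.
    have cb : src u.2 = rng b'.
      have := congr1 (act X u.1.2^-1) (etrans (esym (CEF _ EFu)) c2).
      by rewrite actK /b' rng_act.
    apply: (key _ _ EFt EFu a' b' ca cb).
    apply: (gmul_l SE SF).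
    + by rewrite -up_mul//; exists t, a'.
    + by rewrite -up_mul//; exists u, b'.
    by rewrite /= !actVK.
  apply: ne; apply: (key _ _ EFt EFu a b c1 c2).
  apply: (gmul_r SE SF).
  + by rewrite -up_mul//; exists t, a.
  + by rewrite -up_mul//; exists u, b.
  by [].
Qed.

Lemma SGL_set0 : SGL_elt set0.
Proof. by split. Qed.

Lemma SGL_star_elt F : SGL_elt F -> SGL_elt (SGL_star F).
Proof.
move=> [finF C O]; split; first exact: finite_image.
  by move=> _ [t Ft <-] /=; rewrite C// actK.
move=> _ _ [t Ft <-] [u Fu <-] ne; have [|o1 o2] := O t u Ft Fu; last by split.
by apply: contra_not ne => ->.
Qed.

Lemma up_star F : SGL_elt F -> up (SGL_star F) = SGL_star (up F).
Proof.
move=> SF; have [_ C _] := SF; apply/seteqP; split => t.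
  move=> [_ [x [[u Fu <-] /= cx ->]]].
  have ex : u.1.2 .* (u.1.2^-1 .* x) = x by rewrite actVK.
  exists (ext u (u.1.2^-1 .* x)).
    exists u, (u.1.2^-1 .* x); split=> //.
    by rewrite rng_act -cx C// actK.
  by rewrite /ext/= ex -[in LHS]cocV ex.
move=> [_ [u [x [Fu cx ->]]] <-]; exists (u.2, u.1.2^-1, u.1.1), (u.1.2 .* x).
split; first by exists u.
  exact: comp_l (C _ Fu) cx.
by rewrite /ext/= actK cocV.
Qed.

Lemma gmul_star F : SGL_elt F ->
  gmul (gmul (up F) (SGL_star (up F))) (up F) = up F.
Proof.
move=> SF; apply/seteqP; split => -[[x g] z].
  move=> [_ [c [y' [/= [a [b [y [/= Fa [t Ft [ey eb ey']] ->]]]] Fc ->]]]].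
  have := up_r SF Fa Ft (esym ey); case: t Ft ey eb ey' => [[p q] r] /=.
  move=> Ft ey <- ey' [ep eq _]; subst p q y'.
  by rewrite mulgV mul1g.
move=> Ft; exists 1, g, x; split=> //=; last by rewrite mul1g.
by exists g, g^-1, z; split=> //=; [exists (x, g, z)|rewrite mulgV].
Qed.

Lemma SGL_mulA D E F : SGL_elt D -> SGL_elt E -> SGL_elt F ->
  SGL_mul D (SGL_mul E F) = SGL_mul (SGL_mul D E) F.
Proof.
move=> SD SE SF; have SDE := SGL_mul_elt SD SE; have SEF := SGL_mul_elt SE SF.
by apply: up_inj; rewrite ?up_mul ?gmulA//; exact: SGL_mul_elt.
Qed.

Lemma SGL_starK F : SGL_star (SGL_star F) = F.
Proof.
apply/seteqP; split => [_ [_ [[[x g] z] Ft <-] <-]|[[x g] z] Ft] /=.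
  by rewrite invgK.
by exists (z, g^-1, x); [exists (x, g, z)|rewrite /= invgK].
Qed.

Lemma SGL_mulK F : SGL_elt F -> SGL_mul (SGL_mul F (SGL_star F)) F = F.
Proof.
move=> SF; have SF' := SGL_star_elt SF; have SFF := SGL_mul_elt SF SF'.
apply: up_inj => //; first exact: SGL_mul_elt.
by rewrite !up_mul// up_star// gmul_star.
Qed.

Lemma SGL_idem E t : SGL_elt E -> SGL_mul E E = E -> up E t ->
  t = (t.1.1, 1, t.1.1).
Proof.
move=> SE EE; case: t => [[x g] z] Et; have := Et.
rewrite -{1}EE up_mul// => -[a [b [y [/= Ea Eb eg]]]].
have [_ ez] := up_l SE Ea Et erefl; have [ex eb] := up_r SE Eb Et erefl.
subst z b y; move: eg; rewrite -{1}(mul1g g) => /mulIg a1; subst a.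
by have [<-] := up_l SE Ea Et erefl.
Qed.

Lemma SGL_idemC E F : SGL_elt E -> SGL_elt F ->
  SGL_mul E E = E -> SGL_mul F F = F -> SGL_mul E F = SGL_mul F E.
Proof.
move=> SE SF EE FF; apply: up_inj; [exact: SGL_mul_elt..|].
rewrite !up_mul//.
have sub A B : SGL_elt A -> SGL_elt B -> SGL_mul A A = A -> SGL_mul B B = B ->
    gmul (up A) (up B) `<=` gmul (up B) (up A).
  move=> SA SB AA BB [[x g] z] [a [b [y [/= Aa Bb ->]]]].
  have /= [ea ey] := SGL_idem SA AA Aa; have /= [eb ez] := SGL_idem SB BB Bb.
  by subst a y b z; exists 1, 1, x.
by apply/seteqP; split; exact: sub.
Qed.

End SelfSimilar.

Arguments triple {k} G L.

HB.mixin Record Semigroup_isInverseSemigroup0 S of Semigroup S := {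
  zeros : S;
  star : S -> S;
  mul0s : forall s : S, zeros * s = zeros;
  muls0 : forall s : S, s * zeros = zeros;
  mul_starK : forall s : S, s * star s * s = s;
  star_mulK : forall s : S, star s * s * star s = star s;
  star_uniq : forall s t : S, s * t * s = s -> t * s * t = t -> t = star s
}.

#[short(type="inverseSemigroup0Type")]
HB.structure Definition InverseSemigroup0 :=
  {S of Semigroup_isInverseSemigroup0 S & Semigroup S}.

Definition idempotents {S : semigroupType} : set S := [set e | e * e = e].

Lemma pseudoinverse_uniq (S : semigroupType) (s t u : S) :
  (forall e f : S, e * e = e -> f * f = f -> e * f = f * e) ->
  s * t * s = s -> t * s * t = t -> s * u * s = s -> u * s * u = u -> t = u.
Proof.
move=> C sts tst sus usu.
have idm (a b : S) : a * b * a = a -> (b * a) * (b * a) = b * a.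
  by move=> h; rewrite -mulgA (mulgA a) h.
have idm' (a b : S) : a * b * a = a -> (a * b) * (a * b) = a * b.
  by rewrite mulgA => ->.
have ts : t * s = u * s.
  transitivity (t * s * (u * s)); first by rewrite -mulgA (mulgA s u s) sus.
  by rewrite C ?idm// -mulgA (mulgA s t s) sts.
have st : s * t = s * u.
  transitivity (s * u * (s * t)); first by rewrite mulgA sus.
  by rewrite C ?idm'// mulgA sts.
by rewrite -tst ts -mulgA st mulgA usu.
Qed.

Section InverseSemigroup.
Context {S : inverseSemigroup0Type}.
Implicit Types s t e f : S.

Lemma idem_mulC e f : idempotents e -> idempotents f -> e * f = f * e.
Proof.
move=> ee ff.
have idm (a b : S) : idempotents a -> idempotents b -> idempotents (a * b).
  rewrite /idempotents/= => aa bb; set x := star (a * b).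
  have x1 : a * b * x * (a * b) = a * b := mul_starK _.
  have x2 : x * (a * b) * x = x := star_mulK _.
  have ex : b * x * a = x.
    apply: star_uniq.
      by rewrite !mulgA -(mulgA a b b) bb -(mulgA _ a a) aa -mulgA.
    rewrite !mulgA -(mulgA _ a a) aa -(mulgA _ b b) bb.
    transitivity (b * (x * (a * b) * x) * a); first by rewrite !mulgA.
    by rewrite x2.
  have xx : x * x = x.
    transitivity (b * x * a * (b * x * a)); first by rewrite ex.
    transitivity (b * (x * (a * b) * x) * a); first by rewrite !mulgA.
    by rewrite x2.
  suff -> : a * b = x by [].
  have -> : x = star x by apply: star_uniq; rewrite !xx.
  exact: star_uniq.
have ef := idm _ _ ee ff; have fe := idm _ _ ff ee.
rewrite /idempotents/= in ef fe ee ff.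
have -> : f * e = star (e * f).
  apply: star_uniq; rewrite !mulgA.
    by rewrite -(mulgA e f f) ff -(mulgA _ e e) ee -mulgA.
  by rewrite -(mulgA f e e) ee -(mulgA _ f f) ff -mulgA.
by apply: star_uniq; rewrite !ef.
Qed.

End InverseSemigroup.

Section Filters.
Context {S : inverseSemigroup0Type}.

Definition idem_le (e f : S) := e * f = e.

Definition is_filter (F : set S) := [/\ F `<=` idempotents, F !=set0,
  forall e f, F e -> F f -> F (e * f) &
  forall e f, F e -> idempotents f -> idem_le e f -> F f].

End Filters.

Definition filter_space (S : inverseSemigroup0Type) : Type :=
  {F : set S | F \in [set F | is_filter F /\ ~ F zeros]}.

HB.instance Definition _ (S : inverseSemigroup0Type) := SubChoice.on (filter_space S).

Section FilterSpace.
Context (S : inverseSemigroup0Type).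

Definition filter_basic (e : S) (es : seq S) : set (filter_space S) :=
  [set F | val F e /\ forall f, f \in es -> ~ val F f].

Definition filter_subbase : set (set (filter_space S)) :=
  [set A | exists e es, [/\ idempotents e,
     forall f, f \in es -> idempotents f & A = filter_basic e es]].

HB.instance Definition _ :=
  isSubBaseTopological.Build (filter_space S) filter_subbase id.

Definition ultrafilters : set (filter_space S) :=
  [set F | forall F' : filter_space S, val F `<=` val F' -> F = F'].

Definition tight_filters : set (filter_space S) := closure ultrafilters.

Definition tight_spectrum : topologicalType := set_type tight_filters.

End FilterSpace.

Section Germs.
Context (S : inverseSemigroup0Type).

Definition germ_pair : Type :=
  {p : S * tight_spectrum S |
    p \in [set p : S * tight_spectrum S |
            val (val p.2) (star p.1 * p.1)]}.

HB.instance Definition _ := Choice.on germ_pair.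

Definition germ_rel : rel germ_pair := fun p q =>
  `[< (val p).2 = (val q).2 /\
      exists2 e, val (val (val p).2) e & (val p).1 * e = (val q).1 * e >].

Lemma tight_filterP (F : tight_spectrum S) : is_filter (val (val F)).
Proof. by case: F => -[F /= +] _ => /set_mem[]. Qed.

Lemma germ_rel_refl : reflexive germ_rel.
Proof.
move=> p; apply/asboolP; split=> //.
by have [_ [e Fe] _ _] := tight_filterP (val p).2; exists e.
Qed.

Lemma germ_rel_sym : symmetric germ_rel.
Proof.
have sub p q : germ_rel p q -> germ_rel q p.
  by move=> /asboolP[pq [e Fe pe]]; apply/asboolP; split=> //; exists e; rewrite -?pq.
by move=> p q; apply/idP/idP; exact: sub.
Qed.

Lemma germ_rel_trans : transitive germ_rel.
Proof.
move=> q p r /asboolP[pq [e Fe pe]] /asboolP[qr [f Ff qf]]; apply/asboolP.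
rewrite pq in Fe *; have [FE _ FM _] := tight_filterP (val q).2.
split=> //; exists (e * f); first exact: FM.
have [ee ff] := (FE _ Fe, FE _ Ff).
by rewrite mulgA pe -mulgA (idem_mulC ee ff) !mulgA qf.
Qed.

Canonical germ_equiv :=
  EquivRel germ_rel germ_rel_refl germ_rel_sym germ_rel_trans.

(** [tight_groupoid S] is the topological space underlying the groupoid of
    germs; being Hausdorff does not involve the groupoid operations. *)
Definition tight_groupoid : Type := {eq_quot germ_equiv}%qT.

HB.instance Definition _ := Choice.on tight_groupoid.
HB.instance Definition _ := EqQuotient.on tight_groupoid.

(** The germs of [s] at the points of [V] in the domain of [s].  The open
    subsets of that domain are its intersections with the open sets [V]. *)
Definition germ_basic (s : S) (V : set (tight_spectrum S)) :
    set tight_groupoid :=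
  [set (\pi_tight_groupoid p)%qT
    | p in [set p : germ_pair | (val p).1 = s /\ V (val p).2]].

Definition germ_subbase : set (set tight_groupoid) :=
  [set A | exists s V, open V /\ A = germ_basic s V].

HB.instance Definition _ :=
  isSubBaseTopological.Build tight_groupoid germ_subbase id.

End Germs.

Section SGLSemigroup.
Context (k : nat) (G : groupType) (L : kgraph k) (X : self_similar G L).

Definition SGL : Type :=
  {F : set (triple G L) | F \in [set F | SGL_elt X F]}.

HB.instance Definition _ := SubChoice.on SGL.

Implicit Types E F : SGL.

Lemma SGLP F : SGL_elt X (val F).
Proof. by case: F => F /= /set_mem. Qed.

Definition mkSGL (F : set (triple G L)) (SF : SGL_elt X F) : SGL :=
  exist _ F (mem_set SF).

Definition SGL_op E F : SGL := mkSGL (SGL_mul_elt (SGLP E) (SGLP F)).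

Definition SGL_zero : SGL := mkSGL (SGL_set0 X).

Definition SGL_inv F : SGL := mkSGL (SGL_star_elt (SGLP F)).

Lemma SGL_opA : associative SGL_op.
Proof. by move=> D E F; apply: val_inj; apply: SGL_mulA; exact: SGLP. Qed.

HB.instance Definition _ := isSemigroup.Build SGL SGL_opA.

Lemma SGL_op0s F : SGL_zero * F = SGL_zero.
Proof.
apply/val_inj/seteqP; split=> [t|//].
by move=> [? [? [? [? [? [? [? [? []]]]]]]]].
Qed.

Lemma SGL_ops0 F : F * SGL_zero = SGL_zero.
Proof.
apply/val_inj/seteqP; split=> [t|//].
by move=> [? [? [? [? [? [? [? [? [? []]]]]]]]]].
Qed.

Lemma SGL_op_invK F : F * SGL_inv F * F = F.
Proof. by apply: val_inj; apply: SGL_mulK; exact: SGLP. Qed.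

Lemma SGL_inv_opK F : SGL_inv F * F * SGL_inv F = SGL_inv F.
Proof.
have e : SGL_inv (SGL_inv F) = F by apply: val_inj; exact: SGL_starK.
by have := SGL_op_invK (SGL_inv F); rewrite e.
Qed.

Lemma SGL_inv_uniq E F : E * F * E = E -> F * E * F = F -> F = SGL_inv E.
Proof.
move=> EFE FEF; apply: (pseudoinverse_uniq _ EFE FEF).
- move=> A B /(congr1 val) AA /(congr1 val) BB; apply: val_inj.
  by apply: SGL_idemC => //; exact: SGLP.
- exact: SGL_op_invK.
exact: SGL_inv_opK.
Qed.

HB.instance Definition _ := Semigroup_isInverseSemigroup0.Build SGL
  SGL_op0s SGL_ops0 SGL_op_invK SGL_inv_opK SGL_inv_uniq.

End SGLSemigroup.

(* Main.v *)
(* An idempotent is a finite family of mutually orthogonal paths, so a tight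
   filter containing it contains a singleton [pt p] with [p] a member. Hence
   two elements [s], [s'] have the same germ at a tight filter [F] if and
   only if they share an extended triple [t] with [pt t.2] in [F]. Two
   distinct triples over a common path [la] share an extension along [x]
   only when they are [(mu, g, la)] and [(mu, h, la)] and [x] is strongly
   fixed by [h^-1 * g].

   If these paths are exhausted by a finite set [M], then the filters that
   contain [pt la] but no [pt (la ** y)], [y] in [M], form an open set over
   which the two germs never meet. If instead the paths from [v] strongly
   fixed by [g <> 1] are not exhausted, then for every finite [M] there is
   an ultrafilter containing [pt x] for some strongly fixed [x], but no
   [pt y] with [y] in [M]. At a cluster point of these ultrafilters the germs of
   [{(v, g, v)}] and [{(v, 1, v)}] differ, although they cannot be
   separated. *)

Require Import Defs.
From mathcomp Require Import all_boot finmap all_classical.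
From mathcomp.analysis.topology_theory Require Import topology.

Set Implicit Arguments.
Unset Strict Implicit.
Unset Printing Implicit Defensive.

Local Open Scope group_scope.
Local Open Scope classical_set_scope.

(** Subbasic sets suffice because a filter is closed under finite intersections and supersets. [U]
    need not be given by points: for [germ_nbhs] it consists of the sets [A] that satisfy the
    claim. *)
Lemma subbase_cvg (T : topologicalType) (D : set (set T)) (p : T)
    (U : set_system T) : Filter U ->
  (forall O : set T, open O ->
     exists2 D', D' `<=` finI_from D id & \bigcup_(A in D') A = O) ->
  (forall A, D A -> A p -> U A) -> U --> p.
Proof.
move=> FU openD UD B; rewrite nbhsE => -[O [Oo Op] OB].
have [D' D'D DO] := openD O Oo; subst O.
case: Op => A D'A Ap; have [I ID IA] := D'D A D'A; subst A.
have BI : \bigcap_(i in [set` I]) i `<=` B.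
  by move=> x Ix; apply: OB; exists (\bigcap_(i in [set` I]) i).
apply: filterS BI _; apply: filter_bigI => i Ii.
by apply: UD; [apply: set_mem; exact: ID|exact: Ap].
Qed.

(** * Filters of idempotents: ultrafilters and compactness *)

Section IdempotentFilters.
Context {S : inverseSemigroup0Type}.
Implicit Types (e f h : S) (F : filter_space S).

Lemma idempotents_mul e f : idempotents e -> idempotents f ->
  idempotents (e * f).
Proof.
move=> ee ff; have ef := idem_mulC ee ff; rewrite /idempotents/= in ee ff *.
by rewrite mulgA -(mulgA e f e) -ef mulgA ee -mulgA ff.
Qed.

Lemma idempotents_star (s : S) : idempotents (star s * s).
Proof. by rewrite /idempotents/= mulgA star_mulK. Qed.

Lemma filter_spaceP F : is_filter (val F) /\ ~ val F zeros.
Proof. by case: F => F /= /set_mem. Qed.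

Lemma filter_idem F e : val F e -> idempotents e.
Proof. by have [[FI _ _ _] _] := filter_spaceP F; exact: FI. Qed.

Lemma filter_mul F e f : val F e -> val F f -> val F (e * f).
Proof. by have [[_ _ FM _] _] := filter_spaceP F; exact: FM. Qed.

Lemma filter_up F e f : val F e -> idempotents f -> idem_le e f -> val F f.
Proof. by have [[_ _ _ FU] _] := filter_spaceP F; exact: FU. Qed.

Lemma filter_mull F e f : idempotents e -> idempotents f ->
  val F (e * f) -> val F e.
Proof.
move=> ee ff Fef; apply: (filter_up Fef ee).
by rewrite /idem_le -mulgA -(idem_mulC ee ff) mulgA ee.
Qed.

Lemma filter_mulr F e f : idempotents e -> idempotents f ->
  val F (e * f) -> val F f.
Proof. by move=> ee ff; rewrite (idem_mulC ee ff); exact: filter_mull. Qed.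

Lemma filter_nz F e f : val F e -> val F f -> e * f <> zeros.
Proof.
move=> Fe Ff ef0; have := filter_mul Fe Ff; rewrite ef0.
by have [] := filter_spaceP F.
Qed.

Definition mk_filter (A : set S) (FA : is_filter A) (A0 : ~ A zeros) :
  filter_space S := exist _ A (mem_set (conj FA A0)).

(** The filter generated by [F] and [e] omits zero as soon as [e] meets every member of [F], so
    maximality makes it equal to [F]. *)
Lemma ultrafilter_meet F e : ultrafilters F -> idempotents e ->
  (forall f, val F f -> f * e <> zeros) -> val F e.
Proof.
move=> uF ee Fe; have [[_ [f0 Ff0] _ _] _] := filter_spaceP F.
pose A : set S :=
  [set h | idempotents h /\ exists2 f, val F f & idem_le (f * e) h].
have FA : is_filter A.
  split.
  - by move=> h [].
  - exists e; split=> //; exists f0 => //; rewrite /idem_le -mulgA.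
    by congr (_ * _).
  - move=> h h' [hh [f Ff fh]] [hh' [f' Ff' fh']]; split.
      exact: idempotents_mul.
    exists (f * f'); first exact: filter_mul.
    have [If If'] := (filter_idem Ff, filter_idem Ff').
    have -> : f * f' * e = (f * e) * (f' * e).
      rewrite -[RHS]mulgA (mulgA e f') (idem_mulC ee If') -(mulgA f') ee.
      by rewrite mulgA.
    rewrite /idem_le in fh fh' *; rewrite -[in RHS]fh -[in RHS]fh'.
    have Ife' : idempotents (f' * e) by exact: idempotents_mul.
    rewrite -[RHS]mulgA (mulgA h) (idem_mulC hh Ife').
    by rewrite -(mulgA (f' * e)) !mulgA.
  - move=> h h' [hh [f Ff fh]] hh' hh1; split=> //; exists f => //.
    by rewrite /idem_le in fh hh1 *; rewrite -fh -mulgA hh1.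
have A0 : ~ A zeros.
  by move=> [_ [f /Fe fe0]]; rewrite /idem_le muls0 => /esym.
have -> : F = mk_filter FA A0.
  apply: uF => f Ff; split; first exact: filter_idem Ff.
  exists f => //; have If := filter_idem Ff.
  by rewrite /idem_le (idem_mulC If ee) -mulgA If.
split=> //; exists f0 => //; rewrite /idem_le -mulgA.
by congr (_ * _).
Qed.

Lemma ultrafilter_exists e : idempotents e -> e <> zeros ->
  exists2 F, ultrafilters F & val F e.
Proof.
move=> ee e0.
pose P (A : set S) := A = set0 \/ [/\ is_filter A, ~ A zeros & A e].
have [|A [PA Amax]] := @Zorn_bigcup _ P.
- move=> C CP Ctot.
  have [[A CA [x Ax]]|C0] := pselect (exists2 A, C A & A !=set0).
    right; have nz B y : C B -> B y -> [/\ is_filter B, ~ B zeros & B e].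
      by move=> /CP[-> //|].
    have [_ _ Ae] := nz _ _ CA Ax.
    split; last by exists A.
      split.
      + by move=> f [B CB Bf]; have [[+ _ _ _] _ _] := nz _ _ CB Bf; exact.
      + by exists e, A.
      + move=> f h [B CB Bf] [B' CB' B'h].
        have [BB'|B'B] := Ctot _ _ CB CB'.
          exists B' => //; have [[_ _ + _] _ _] := nz _ _ CB' B'h.
          by apply=> //; exact: BB'.
        exists B => //; have [[_ _ + _] _ _] := nz _ _ CB Bf.
        by apply=> //; exact: B'B.
      + move=> f h [B CB Bf] hh fh; exists B => //.
        by have [[_ _ _ FU] _ _] := nz _ _ CB Bf; exact: FU Bf hh fh.
    by move=> [B CB B0]; have [_ + _] := nz _ _ CB B0; exact.
  left; apply/seteqP; split=> // x [A CA Ax]; apply: C0.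
  by exists A => //; exists x.
(* The principal filter of [e] rules out the empty set as the maximal element. *)
pose B : set S := [set h | idempotents h /\ idem_le e h].
have PB : P B.
  right; split; last by split=> //; exact: ee.
    split.
    - by move=> h [].
    - by exists e; split=> //; exact: ee.
    - move=> h h' [hh eh] [hh' eh']; split; first exact: idempotents_mul.
      by rewrite /idem_le in eh eh' *; rewrite mulgA eh.
    - move=> h h' [hh eh] hh' hh1; split=> //.
      by rewrite /idem_le in eh hh1 *; rewrite -eh -mulgA hh1.
  by move=> [_]; rewrite /idem_le muls0 => /esym.
have [A0|[FA A0 Ae]] := PA.
  exfalso; apply: (Amax B) => //; rewrite A0; split=> // /(_ e); apply.
  by split=> //; exact: ee.
exists (mk_filter FA A0) => // F' AF'.
apply: val_inj => /=; apply/seteqP; split=> // f F'f.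
apply: contrapT => nAf; apply: (Amax (val F')).
  by split=> // /(_ f F'f).
right; have [FF' F'0] := filter_spaceP F'; split=> //; exact: AF'.
Qed.

Lemma open_filter_basic e (es : seq S) : idempotents e ->
  (forall f, f \in es -> idempotents f) -> open (filter_basic e es).
Proof.
move=> ee ees.
exists [set filter_basic e es]; last by rewrite bigcup_set1.
move=> _ ->; apply: finI_from1.
by exists e, es.
Qed.

Lemma filter_space_openP (O : set (filter_space S)) : open O ->
  exists2 D, D `<=` finI_from (@filter_subbase S) id & \bigcup_(A in D) A = O.
Proof. by []. Qed.

(** An ultrafilter [U] on the space converges to the filter of those [h] that lie in [U]-almost
    every [F]. The presence of [e] keeps this limit nonempty. *)
Lemma filter_basic_compact e : idempotents e -> compact (filter_basic e [::]).
Proof.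
move=> ee; rewrite compact_ultra => U UU Ue.
pose A : set S := [set h | idempotents h /\ U [set F | val F h]].
have FA : is_filter A.
  split.
  - by move=> h [].
  - by exists e; split=> //; apply: filterS Ue => F [].
  - move=> h h' [hh Uh] [hh' Uh']; split; first exact: idempotents_mul.
    apply: filterS (filterI Uh Uh') => F [Fh Fh']; exact: filter_mul.
  - move=> h h' [hh Uh] hh' hh1; split=> //.
    by apply: filterS Uh => F Fh; exact: (filter_up Fh).
have A0 : ~ A zeros.
  by move=> [_] /filter_ex [F F0]; have [_] := filter_spaceP F; exact.
exists (mk_filter FA A0); split.
  by split=> //; split=> //; apply: filterS Ue => F [].
apply: (subbase_cvg _ filter_space_openP).
move=> B [f [es [ff ees ->]]] [/= [_ Uf] nes].
apply: filterI => //=.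
elim: es ees nes => [|h es IH] ees nes; first by apply: filterS filterT.
have hh : idempotents h by apply: ees; rewrite mem_head.
have [Uh|nUh] := @in_ultra_setVsetC _ U [set F | val F h] UU.
  by case: (nes h (mem_head _ _)).
have /(filterI nUh) : U [set F | forall g, g \in es -> ~ val F g].
  by apply: IH => g ges; [apply: ees|apply: nes]; rewrite in_cons ges orbT.
apply: filterS => F [nFh Fes] g; rewrite in_cons => /orP[/eqP -> //|].
exact: Fes.
Qed.

End IdempotentFilters.

(** * Germs over the tight spectrum and the Hausdorff criterion *)

Section TightGroupoid.
Context {S : inverseSemigroup0Type}.
Implicit Types (s t e f : S) (F : tight_spectrum S) (p q : germ_pair S).

Definition tight_basic e (es : seq S) : set (tight_spectrum S) :=
  [set F | filter_basic e es (val F)].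

Lemma open_tight_basic e (es : seq S) : idempotents e ->
  (forall f, f \in es -> idempotents f) -> open (tight_basic e es).
Proof.
move=> ee ees; have /open_comp := open_filter_basic ee ees; apply => F _.
exact: initial_continuous.
Qed.

Lemma tight_approx F e (es : seq S) : idempotents e ->
  (forall f, f \in es -> idempotents f) -> tight_basic e es F ->
  exists2 F', ultrafilters F' & filter_basic e es F'.
Proof.
move=> ee ees FV; case: F FV => F tF /= FV; have := set_mem tF.
move=> /(_ (filter_basic e es)) [|F' [uF' F'V]]; last by exists F'.
by apply: open_nbhs_nbhs; split => //; exact: open_filter_basic.
Qed.

(** Equality of the germs of [s] and [t] at [F], freed from the domain conditions that [germ_pair]
    carries. *)
Definition agree F s t := exists2 e, val (val F) e & s * e = t * e.

Lemma germ_pairP p : val (val (val p).2) (star (val p).1 * (val p).1).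
Proof. by case: p => -[s F] /= /set_mem. Qed.

Definition mk_germ s F (Fs : val (val F) (star s * s)) : germ_pair S :=
  exist _ (s, F) (mem_set Fs).

Lemma germ_eqP p q :
  (\pi_(tight_groupoid S) p)%qT = (\pi_(tight_groupoid S) q)%qT <->
  (val p).2 = (val q).2 /\ agree (val p).2 (val p).1 (val q).1.
Proof.
by split=> [/eqmodP/asboolP //|pq]; apply/eqmodP/asboolP.
Qed.

Lemma germ_basic_nbhs p (V : set (tight_spectrum S)) : open V -> V (val p).2 ->
  nbhs (\pi_(tight_groupoid S) p)%qT (germ_basic (val p).1 V).
Proof.
move=> oV Vp; apply: open_nbhs_nbhs; split; last by exists p.
exists [set germ_basic (val p).1 V]; last by rewrite bigcup_set1.
by move=> _ ->; apply: finI_from1; exists (val p).1, V.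
Qed.

Lemma germ_basicI s t V W :
  germ_basic s V `&` germ_basic t W !=set0 ->
  exists F, V F /\ W F /\ [/\ val (val F) (star s * s),
    val (val F) (star t * t) & agree F s t].
Proof.
move=> [_ [[p [ps Vp] <-] [q [qt Wq] qp]]].
have [e a] := (germ_eqP p q).1 (esym qp).
exists (val p).2; split=> //; split; first by rewrite e.
split; [by rewrite -ps; exact: germ_pairP| |by rewrite -ps -qt].
by rewrite -qt e; exact: germ_pairP.
Qed.

Lemma tight_groupoid_openP (O : set (tight_groupoid S)) : open O ->
  exists2 D, D `<=` finI_from (@germ_subbase S) id & \bigcup_(A in D) A = O.
Proof. by []. Qed.

(** A subbasic set around the germ may come from another element [s]. The two elements agree below
    some [e] in the filter, and over the filters containing [e * (star s * s)] their germs
    coincide. *)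
Lemma germ_nbhs p (A : set (tight_groupoid S)) :
  nbhs (\pi_(tight_groupoid S) p)%qT A ->
  exists2 V, open V /\ V (val p).2 &
    forall q, (val q).1 = (val p).1 -> V (val q).2 ->
      A (\pi_(tight_groupoid S) q)%qT.
Proof.
move: A; apply: (@subbase_cvg _ (@germ_subbase S) _ (fun A =>
  exists2 V, open V /\ V (val p).2 & forall q, (val q).1 = (val p).1 ->
    V (val q).2 -> A (\pi_(tight_groupoid S) q)%qT)).
- split.
  + by exists setT => //; split=> //; exact: openT.
  + move=> A B [V [oV Vp] VA] [W [oW Wp] WB]; exists (V `&` W).
      by split=> //; exact: openI.
    by move=> q qp [Vq Wq]; split; [exact: VA|exact: WB].
  + by move=> A B AB [V Vp VA]; exists V => // q qp Vq; exact/AB/VA.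
- exact: tight_groupoid_openP.
move=> _ [s [V [oV ->]]] [p' [p's Vp'] /germ_eqP[Fpp' [e Fe pe]]].
have ee := filter_idem Fe; rewrite Fpp' in Fe.
have ss : idempotents (star s * s) := idempotents_star s.
exists (V `&` tight_basic (e * (star s * s)) [::]).
  split.
    apply: openI => //; apply: open_tight_basic => //.
    exact: idempotents_mul.
  rewrite -Fpp'; split=> //; split=> //.
  apply: filter_mul; first by rewrite Fpp'.
  by rewrite -p's; exact: germ_pairP.
move=> q qp [Vq [Fq _]].
exists (mk_germ (filter_mulr ee ss Fq)); first by split.
apply/germ_eqP; split=> //=; exists e; first exact: filter_mull Fq.
by rewrite qp -p's.
Qed.

Lemma tight_spectrum_sep F F' : F <> F' -> exists V W,
  [/\ open V, open W, V F, W F' & V `&` W = set0].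
Proof.
wlog [e Fe F'e] : F F' / exists2 e, val (val F) e & ~ val (val F') e.
  move=> H FF'.
  have [h|nh] := pselect (exists2 e, val (val F) e & ~ val (val F') e).
    exact: H.
  have [h|nh'] := pselect (exists2 e, val (val F') e & ~ val (val F) e).
    have [|V [W [oV oW VF WF VW]]] := H _ _ h; first exact/nesym.
    by exists W, V; rewrite setIC.
  exfalso; apply: FF'; apply: val_inj; apply: val_inj.
  apply/seteqP; split=> e Fe; apply: contrapT => nFe.
    by apply: nh; exists e.
  by apply: nh'; exists e.
move=> _; have ee := filter_idem Fe.
(* A basic set must name an idempotent that is present; any member of [F'] will do. *)
have [_ [f F'f] _ _] := tight_filterP F'.
exists (tight_basic e [::]), (tight_basic f [:: e]); split.
- exact: open_tight_basic.
- apply: open_tight_basic; first exact: filter_idem F'f.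
  by move=> h; rewrite inE => /eqP ->.
- by split.
- by split=> // h; rewrite inE => /eqP ->.
- rewrite -subset0 => F0 [[F0e _] [_ /(_ e)]]; apply=> //.
  by rewrite mem_head.
Qed.

(* Germs over different filters are always separated, so only pairs of germs
   over a common filter matter. *)
Lemma tight_groupoid_hausdorff :
  hausdorff_space (tight_groupoid S) <->
  forall s t F, val (val F) (star s * s) -> val (val F) (star t * t) ->
    (forall V, open V -> V F ->
      exists F', [/\ V F', val (val F') (star s * s),
        val (val F') (star t * t) & agree F' s t]) ->
    agree F s t.
Proof.
split=> [H s t F Fs Ft st|H].
  have /germ_eqP[] // : (\pi_(tight_groupoid S) (mk_germ Fs))%qT =
      (\pi_(tight_groupoid S) (mk_germ Ft))%qT.
  apply: H => A B /germ_nbhs[V [oV VF] VA] /germ_nbhs[W [oW WF] WB].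
  have [F' [[VF' WF'] F's F't a]] := st _ (openI oV oW) (conj VF WF).
  exists (\pi_(tight_groupoid S) (mk_germ F's))%qT; split; first exact: VA.
  have -> : (\pi_(tight_groupoid S) (mk_germ F's))%qT =
      (\pi_(tight_groupoid S) (mk_germ F't))%qT by apply/germ_eqP.
  exact: WB.
move=> x y; rewrite -[x]reprK -[y]reprK; move: (repr x) (repr y) => p q pq.
apply/germ_eqP.
have [Fpq|/tight_spectrum_sep] := pselect ((val p).2 = (val q).2).
  split=> //; apply: H.
  - exact: germ_pairP.
  - by rewrite Fpq; exact: germ_pairP.
  move=> V oV Vp; have Vq := Vp; rewrite Fpq in Vq.
  have := pq _ _ (germ_basic_nbhs oV Vp) (germ_basic_nbhs oV Vq).
  by move=> /germ_basicI[F [VF [_ [Fp Fq a]]]]; exists F.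
move=> [V [W [oV oW Vp Wq VW]]].
have := pq _ _ (germ_basic_nbhs oV Vp) (germ_basic_nbhs oW Wq).
by move=> /germ_basicI[F [VF [WF _]]]; have : (V `&` W) F by []; rewrite VW.
Qed.

End TightGroupoid.

(** By [ultrafilter_meet], each missing idempotent is annihilated by some member of [F]; the product
    of these members annihilates them all. *)
Lemma ultrafilter_avoid (S : inverseSemigroup0Type) (F : filter_space S)
    (es : seq S) : ultrafilters F ->
  (forall e, e \in es -> idempotents e /\ ~ val F e) ->
  exists2 f, val F f & forall e, e \in es -> f * e = zeros.
Proof.
move=> uF; elim: es => [|e es IH] ees.
  by have [[_ [f Ff] _ _] _] := filter_spaceP F; exists f.
have [h hes|f Ff fes] := IH; first by apply: ees; rewrite in_cons hes orbT.
have [ee nFe] := ees e (mem_head _ _).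
have [f' Ff' f'e] : exists2 f', val F f' & f' * e = zeros.
  apply: contrapT => nf; apply: nFe; apply: ultrafilter_meet => // f' Ff' f'e.
  by apply: nf; exists f'.
exists (f' * f); first exact: filter_mul.
move=> h; rewrite in_cons => /orP[/eqP ->|/fes]; rewrite -mulgA.
  by rewrite (idem_mulC (filter_idem Ff) ee) mulgA f'e mul0s.
by move=> ->; rewrite muls0.
Qed.

(** * Points of paths, tight filters and germs for a self-similar graph *)

Section SelfSimilarGermGroupoid.
Context {k : nat} {G : groupType} {L : kgraph k} (X : self_similar G L).
Implicit Types (g h : G) (p q x y v : L) (t u w : triple G L) (E s : SGL X).

Local Notation "x ** y" := (cmp x y) (at level 40, left associativity).
Local Notation upS E := (up X (val E)).
Local Notation diag x := ((x, 1, x) : triple G L).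

Lemma up_ext E t x : upS E t -> src t.2 = rng x -> upS E (ext X t x).
Proof.
move=> [u [y [Eu cy ->]]] /=; rewrite src_cmp// => cx.
have [_ C _] := SGLP E.
exists u, (y ** x); rewrite rng_cmp//; split=> //.
by rewrite ext_ext//; exact: C.
Qed.

(** Together with [SGL_up_inj], this moves computations to partial bijections, whose composition
    [gmul] involves no [Lmin]. *)
Lemma upM E E' : upS (E * E') = gmul (upS E) (upS E').
Proof. exact: up_mul (SGLP E) (SGLP E'). Qed.

Lemma SGL_up_inj E E' : upS E = upS E' -> E = E'.
Proof. by move=> e; apply/val_inj/(up_inj (SGLP E) (SGLP E')). Qed.

Lemma SGL0P E : E <> zeros -> exists t, upS E t.
Proof.
move=> E0; apply: contrapT => nE; apply: E0; apply: SGL_up_inj.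
apply/seteqP; split=> t; first by move=> Et; case: nE; exists t.
by move=> [u [x [[]]]].
Qed.

Lemma up0 t : ~ upS (zeros : SGL X) t.
Proof. by move=> [u [x [[]]]]. Qed.

Lemma up_idem E t : idempotents E -> upS E t -> t = diag t.2.
Proof.
move=> /(congr1 val) EE Et; have := SGL_idem (SGLP E) EE Et.
by case: t {Et} => [[x g] y] /= [-> ->].
Qed.

(** An idempotent is a partial identity, so multiplying by it on the right restricts [s] to source
    paths in its domain. *)
Lemma mul_idem_up s E t : idempotents E ->
  upS (s * E) t <-> upS s t /\ upS E (diag t.2).
Proof.
move=> EE; rewrite upM; case: t => [[x g] z]; split.
  move=> [a [b [y [/= sa Eb ->]]]]; have /= [ey eb] := up_idem EE Eb.
  by subst b y; rewrite mulg1.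
by move=> [/= st Ez]; exists g, 1, z; rewrite mulg1.
Qed.

Lemma idem_up E : (forall t, upS E t -> t = diag t.2) -> idempotents E.
Proof.
move=> Ed; apply: SGL_up_inj; rewrite upM.
apply/seteqP; split=> [[[x g] z]|t Et].
  move=> [a [b [y [/= Ea Eb ->]]]].
  have /= [ey eb] := Ed _ Eb; have /= [ex ea] := Ed _ Ea; subst b y a x.
  by rewrite mulg1.
have := Ed _ Et; case: t Et => [[x g] z] /= Et [ex eg]; subst x g.
by exists 1, 1, z; rewrite mulg1.
Qed.

Lemma single_elt t : composable X t -> SGL_elt X [set t].
Proof.
move=> ct; split; first exact: finite_set1.
  by move=> _ ->.
by move=> _ _ -> ->.
Qed.

Lemma composable_diag p : composable X (diag p).
Proof. by rewrite /composable /= act1. Qed.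

Definition single t (ct : composable X t) : SGL X := mkSGL (single_elt ct).

(** As a partial bijection, the identity on the extensions of [p]; these idempotents play the role
    of cylinder sets. *)
Definition pt p : SGL X := single (composable_diag p).

Lemma up_pt p w : upS (pt p) w <-> exists2 x, src p = rng x & w = diag (p ** x).
Proof.
split.
  by move=> [_ [x [-> /= cx ->]]]; exists x; rewrite /ext//= act1 coc1.
by move=> [x cx ->]; exists (diag p), x; rewrite /ext/= act1 coc1.
Qed.

Lemma pt_idem p : idempotents (pt p).
Proof. by apply: idem_up => _ /up_pt[x _ ->]. Qed.

Lemma up_ptr p : upS (pt p) (diag p).
Proof. by apply/up_pt; exists (src p); rewrite ?rng_src ?cmp_src. Qed.

Lemma pt_le E p : idempotents E -> upS E (diag p) -> idem_le (pt p) E.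
Proof.
move=> EE Ep; apply: SGL_up_inj; apply/seteqP; split=> t.
  by move=> /(mul_idem_up _ _ EE)[].
move=> pt; apply/(mul_idem_up _ _ EE); split=> //.
move: pt => /up_pt[x cx ->]; have := @up_ext E (diag p) x Ep cx.
by rewrite /ext/= act1 coc1.
Qed.

Lemma pt_neq0 p : pt p <> zeros.
Proof. by move=> p0; have := up_ptr p; rewrite p0; exact: up0. Qed.

Lemma pt_filter_up (F : filter_space (SGL X)) E p : idempotents E ->
  upS E (diag p) -> val F (pt p) -> val F E.
Proof. by move=> EE Ep Fp; apply: (filter_up Fp) => //; exact: pt_le. Qed.

Lemma pt_meet_up p q t : upS (pt p * pt q) t -> exists x y,
  [/\ src p = rng x, src q = rng y, p ** x = q ** y & t = diag (p ** x)].
Proof.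
move=> /(mul_idem_up _ _ (pt_idem q))[/up_pt[x cx ->] /up_pt[y cy [e]]].
by exists x, y.
Qed.

Lemma pt_meet_Lmin p q : pt p * pt q <> zeros -> Lmin p q !=set0.
Proof.
move=> /SGL0P[t /pt_meet_up[x [y [cx cy e _]]]].
by have [al [be [_ [m _ _ _ _]]]] := Lmin_factor cx cy e; exists (al, be).
Qed.

(* The members of an idempotent are orthogonal, so an ultrafilter containing it
   contains the point of one of them, and this passes to limits. *)
Lemma tight_prime (F : tight_spectrum (SGL X)) E : val (val F) E ->
  exists2 p, upS E (diag p) & val (val F) (pt p).
Proof.
move=> FE; have EE := filter_idem FE; have [finE _ _] := SGLP E.
have /finite_seqP[l El] := finE.
apply: contrapT => nF.
have lidem f : f \in [seq pt t.2 | t <- l] -> idempotents f.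
  by move=> /mapP[t _ ->]; exact: pt_idem.
have [] := @tight_approx _ F E _ EE lidem.
  split=> // f /mapP[t tl ->] Ft; apply: nF; exists t.2 => //.
  have Et : upS E t by apply: sub_up; [exact: SGLP|rewrite El].
  by rewrite -(up_idem EE Et).
move=> F' uF' [F'E F'l].
have [|f F'f fl] := @ultrafilter_avoid _ F' [seq pt t.2 | t <- l] uF'.
  by move=> e el; split; [exact: lidem|exact: F'l].
apply: (filter_nz F'f F'E); apply: contrapT => /SGL0P[u].
move=> /(mul_idem_up _ _ EE)[fu [t [x [Et cx [_ _ ex]]]]].
have tl : t \in l by move: Et; rewrite El.
apply: (@up0 u); rewrite -(fl (pt t.2)); last exact/map_f.
apply/(mul_idem_up _ _ (pt_idem _)); split=> //.
by apply/up_pt; exists x => //; rewrite ex.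
Qed.

(** [tight_prime] applies to [pt p * pt q], whose diagonal triples sit at common extensions of [p]
    and [q]. *)
Lemma tight_pt_meet (F : tight_spectrum (SGL X)) p q :
  val (val F) (pt p) -> val (val F) (pt q) -> exists x y,
  [/\ src p = rng x, src q = rng y, p ** x = q ** y
    & val (val F) (pt (p ** x))].
Proof.
move=> Fp Fq.
have [r /pt_meet_up[x [y [cx cy e [er]]]]] := tight_prime (filter_mul Fp Fq).
by rewrite er => Fr; exists x, y.
Qed.

Lemma star_up s t : upS s t -> upS (star s * s) (diag t.2).
Proof.
move=> st; rewrite upM; exists t.1.2^-1, t.1.2, t.1.1.
rewrite mulVg; split=> //=.
  by rewrite (up_star (SGLP s)); exists t.
by case: t st => -[].
Qed.

Lemma up_star_mul s p : upS (star s * s) (diag p) ->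
  exists2 t, upS s t & t.2 = p.
Proof. by rewrite upM => -[a [b [y [/= _ sb _]]]]; exists (y, b, p). Qed.

(** Forward, [tight_prime] picks a path inside both [e] and the domain of [s], and [s * e = s' * e]
    makes the triple there common. Backward, a triple of [s] or [s'] is determined by its source
    path, so over the extensions of [t.2] both consist of extensions of [t]. *)
Lemma agreeP (F : tight_spectrum (SGL X)) s s' : val (val F) (star s * s) ->
  agree F s s' <->
  exists t, [/\ upS s t, upS s' t & val (val F) (pt t.2)].
Proof.
move=> Fs; split=> [[e Fe se]|[t [st s't Ft]]].
  have [p ep Fp] := tight_prime (filter_mul Fe Fs).
  have ee := filter_idem Fe; have ss := idempotents_star s.
  have /= [ep' sp] := (mul_idem_up _ _ ss).1 ep.
  have [t st tp] := up_star_mul sp; subst p; exists t; split=> //.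
  suff : upS (s' * e) t by move=> /(mul_idem_up _ _ ee)[].
  by rewrite -se; apply/(mul_idem_up _ _ ee).
exists (pt t.2) => //; apply: SGL_up_inj.
apply/seteqP; split=> u /(mul_idem_up _ _ (pt_idem _))[su /[dup] tu].
  move=> /up_pt[x cx [ex _]]; apply/(mul_idem_up _ _ (pt_idem _)); split=> //.
  have <- : ext X t x = u.
    apply: (up_r (SGLP s)) => //; exact: up_ext.
  exact: up_ext.
move=> /up_pt[x cx [ex _]]; apply/(mul_idem_up _ _ (pt_idem _)); split=> //.
have <- : ext X t x = u.
  apply: (up_r (SGLP s')) => //; exact: up_ext.
exact: up_ext.
Qed.

Lemma tight_up (F : tight_spectrum (SGL X)) s :
  val (val F) (star s * s) -> exists2 t, upS s t & val (val F) (pt t.2).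
Proof.
move=> Fs; have [_ [e Fe] _ _] := tight_filterP F.
have /(agreeP _ Fs)[t [st _ Ft]] : agree F s s by exists e.
by exists t.
Qed.

(** * Local exhaustion implies Hausdorff *)

Lemma strongly_fixed_cmp g x y : src x = rng y ->
  strongly_fixed X g x -> strongly_fixed X g (x ** y).
Proof.
move=> cxy [gx ax]; split; first by rewrite act_cmp// gx ax act1.
by rewrite coc_cmp// ax coc1.
Qed.

Lemma strongly_fixedVM g h x : strongly_fixed X (h^-1 * g) x <->
  act X g x = act X h x /\ coc X g x = coc X h x.
Proof.
split=> [[]|[e c]]; last first.
  by split; [rewrite actM e actK|rewrite cocM e cocV c mulVg].
rewrite actM cocM => /(congr1 (act X h)); rewrite actVK => e.
by rewrite e cocV => /(congr1 (fun z => coc X h x * z)); rewrite mulVKg mulg1.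
Qed.

(* Triples [(mu, g, la)] and [(mu, h, la)] have the same extension along [x]
   exactly when [x] is strongly fixed by [h^-1 * g]. *)
Lemma agreement_exhausted t u :
  (forall g : G, g <> 1 -> locally_exhausted (strongly_fixed X g)) ->
  composable X t -> composable X u -> t.2 = u.2 -> t <> u ->
  exists m : seq L,
    (forall y, y \in m -> src t.2 = rng y /\ ext X t y = ext X u y) /\
    (forall x, src t.2 = rng x -> ext X t x = ext X u x ->
       forall y, src x = rng y -> exists2 z, z \in m & Lmin (x ** y) z !=set0).
Proof.
move=> H; case: t => [[mu g] la]; case: u => [[xi h] la'] ct cu /= e tu.
subst la'.
have [e|ne] := pselect (mu = xi); last first.
  (* Equal extensions would force [mu = xi], since the factors after them have the same degree;
     hence there is nothing to exhaust. *)
  exists [::]; split=> // x cx [e _]; exfalso; apply: ne.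
  have [|/= -> _ //] := factor_uniq (comp_l ct cx) (comp_l cu cx) _ e.
  have := congr1 deg e.
  rewrite (deg_cmp (comp_l ct cx)) (deg_cmp (comp_l cu cx)) /= !deg_act.
  move=> /ffunP de; apply/ffunP => i; have := de i.
  by rewrite !ffunE => /addIn.
subst xi.
have gh : h^-1 * g <> 1.
  move=> /(congr1 (fun z => h * z)); rewrite mulVKg mulg1 => e.
  by apply: tu; rewrite e.
have [M [finM MS Mex]] := H _ gh (src la) (deg_src la).
have /finite_seqP[m Mm] := finM; subst M; exists m; split=> [y ym|].
  have [/strongly_fixedVM[e c] ry] := MS y ym.
  by split=> //; rewrite /ext/= e c.
move=> x cx [e c] y cxy; have {}e := cmpI (comp_l ct cx) (comp_l cu cx) e.
apply: Mex; last by rewrite rng_cmp.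
by apply: strongly_fixed_cmp => //; apply/strongly_fixedVM.
Qed.

Lemma exhausted_hausdorff :
  (forall g : G, g <> 1 -> locally_exhausted (strongly_fixed X g)) ->
  hausdorff_space (tight_groupoid (SGL X)).
Proof.
move=> H; apply/tight_groupoid_hausdorff => s s' F Fs Fs' cl.
(* Triples of [s] and [s'] at [F] are extended until they share a source path whose point still lies
   in [F]. *)
have [t st Ft] := tight_up Fs; have [u su Fu] := tight_up Fs'.
have [a [b [ca cb eab Fab]]] := tight_pt_meet Ft Fu.
have {st ca} := up_ext st ca; have {su cb} := up_ext su cb.
have {eab} : (ext X t a).2 = (ext X u b).2 by [].
have {Fab} : val (val F) (pt (ext X t a).2) by [].
move: (ext X t a) (ext X u b) => {Ft Fu u a b}t u Ft tu su st.
apply: contrapT => nag.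
have ntu : t <> u.
  by move=> e; subst u; apply: nag; apply/agreeP => //; exists t.
have [m [mtu mex]] :=
  agreement_exhausted H (up_comp (SGLP s) st) (up_comp (SGLP s') su) tu ntu.
have es_idem e : e \in [seq pt (t.2 ** y) | y <- m] -> idempotents e.
  by move=> /mapP[y _ ->]; exact: pt_idem.
have [|F' [[F't F'm] F's _ /(agreeP _ F's)[c [sc s'c F'c]]]] :=
    cl _ (open_tight_basic (pt_idem t.2) es_idem).
  (* [F] lies in this open set: a [pt (t.2 ** y)] in [F] would make [s] and [s'] agree at [F]. *)
  split=> // e /mapP[y /mtu[cy ty] ->] Fy; apply: nag; apply/agreeP => //.
  exists (ext X t y); split=> //; first exact: up_ext.
  by rewrite ty; apply: up_ext => //; rewrite -tu.
(* Over a common extension of [t.2] and [c.2], the extension of [c] equals that of [t] inside [s]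
   and that of [u] inside [s']. *)
have [x [y [cx cy exy F'x]]] := tight_pt_meet F't F'c.
have etc : ext X t x = ext X c y.
  by apply: (up_r (SGLP s)) => //; exact: up_ext.
have etu : ext X t x = ext X u x.
  rewrite etc; apply: (up_r (SGLP s')); try apply: up_ext => //.
  - by rewrite -tu.
  - by rewrite /= -tu.
(* [F'] is only tight. A nearby ultrafilter keeps [pt (t.2 ** x)], still avoids the points over [m],
   and so has a member [f] orthogonal to all of them. *)
have [|F0 uF0 [F0x F0m]] := tight_approx (pt_idem (t.2 ** x)) es_idem (F := F').
  by [].
have [|f F0f fm] := @ultrafilter_avoid _ F0 [seq pt (t.2 ** y) | y <- m] uF0.
  by move=> e em; split; [exact: es_idem|exact: F0m].
have ff := filter_idem F0f.
have /SGL0P[w] := filter_nz F0f F0x.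
move=> /(mul_idem_up _ _ (pt_idem _))[fw /up_pt[z cz [ew _]]].
rewrite src_cmp// in cz.
(* Exhaustion extends [x ** z] by [al] to an extension of some [y'] in [m]. Then [ext X w al] lies
   in [f] and has its source path below [pt (t.2 ** y')], although their product is zero. *)
have [y' y'm [[al be] [/= cal cbe e _]]] := mex x cx etu z cz.
have [cy' _] := mtu y' y'm.
have cal' : src z = rng al by rewrite src_cmp// in cal.
have ewa : w.2 ** al = t.2 ** y' ** be.
  by rewrite -(cmpA cy' cbe) -e ew -(cmpA cx cz) [RHS]cmpA// rng_cmp.
have cwal : src w.2 = rng al by rewrite ew src_cmp ?src_cmp.
apply: (@up0 (ext X w al)); rewrite -(fm (pt (t.2 ** y'))); last exact/map_f.
apply/(mul_idem_up _ _ (pt_idem _)); split; first exact: up_ext.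
by apply/up_pt; exists be; rewrite ?src_cmp//= ewa.
Qed.

(** * Hausdorff implies local exhaustion *)

Lemma ext_vertex g v x : act X g v = v -> rng x = v ->
  ext X (v, g, v) x = (act X g x, coc X g x, x).
Proof.
move=> gv rx; have rgx : rng (act X g x) = v by rewrite rng_act rx.
by rewrite /ext/= -{1}rgx -{1}rx !cmp_rng.
Qed.

Lemma hausdorff_exhausted : hausdorff_space (tight_groupoid (SGL X)) ->
  forall g : G, g <> 1 -> locally_exhausted (strongly_fixed X g).
Proof.
move=> /tight_groupoid_hausdorff H g g1 v v0; apply: contrapT => nM.
have [rv sv] := vertexP v0.
pose SF x := strongly_fixed X g x /\ rng x = v.
have avoid (m : seq L) : (forall y, y \in m -> SF y) ->
    exists2 x, SF x & forall y, y \in m -> Lmin x y = set0.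
  move=> mSF; apply: contrapT => nx; apply: nM; exists [set` m].
  split; [exact: finite_seq|by move=> y /mSF[]|].
  move=> x xg xv; apply: contrapT => nm; apply: nx; exists x => // y ym.
  apply/seteqP; split=> // pq xy; apply: nm; exists y => //.
  by exists pq.
(* The empty family already yields a strongly fixed path from [v]; thus [g] fixes [v] and
   [(v, g, v)] is composable. *)
have [x0 [[gx0 _] rx0] _] := avoid [::] ltac:(by []).
have gv : act X g v = v by rewrite -rx0 -rng_act gx0.
pose D (m : seq L) := forall y, y \in m -> SF y.
(* These sets form a filter base. A cluster point of it is tight, being a limit of ultrafilters, and
   contains no [pt x] with [SF x]. *)
pose B (m : seq L) : set (filter_space (SGL X)) :=
  [set F | ultrafilters F /\ (exists2 x, SF x & val F (pt x)) /\
           forall y, y \in m -> ~ val F (pt y)].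
have FB : Filter (filter_from D B).
  apply: filter_from_filter; first by exists [::].
  move=> m m' Dm Dm'; exists (m ++ m').
    by move=> y; rewrite mem_cat => /orP[/Dm|/Dm'].
  move=> F [uF [Fx nF]]; split; split=> //; split=> // y ym; apply: nF.
    by rewrite mem_cat ym.
  by rewrite mem_cat ym orbT.
have PB : ProperFilter (filter_from D B).
  apply: filter_from_proper => m Dm; have [x SFx xm] := avoid m Dm.
  have [F uF Fx] := ultrafilter_exists (pt_idem x) (@pt_neq0 x).
  exists F; split=> //; split; first by exists x.
  move=> y ym Fy; have := pt_meet_Lmin (filter_nz Fx Fy).
  by rewrite xm// => -[].
have pv x : rng x = v -> upS (pt v) (diag x).
  by move=> rx; apply/up_pt; exists x; rewrite ?sv// -rx cmp_rng.
have [|F0 [[F0v _] clF0]] := filter_basic_compact (pt_idem v) PB.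
  exists [::] => // F [uF [[x [_ rx] Fx] _]]; split=> //.
  by apply: pt_filter_up Fx; [exact: pt_idem|exact: pv].
have tF0 : tight_filters F0.
  move=> W /(clF0 (B [::])) [|F [[uF _] WF]]; last by exists F.
  by exists [::].
pose F : tight_spectrum (SGL X) := exist _ F0 (mem_set tF0).
have cvgv : composable X (v, g, v) by rewrite /composable/= sv gv.
pose s := single cvgv.
have ups x : rng x = v -> upS s (act X g x, coc X g x, x).
  move=> rx; exists (v, g, v), x; split=> //=; first by rewrite sv.
  by rewrite ext_vertex.
have dom_s (F' : filter_space (SGL X)) : val F' (pt v) -> val F' (star s * s).
  apply: pt_filter_up; first exact: idempotents_star.
  exact: star_up (ups v rv).
have dom_v (F' : filter_space (SGL X)) :
    val F' (pt v) -> val F' (star (pt v) * pt v).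
  apply: pt_filter_up; first exact: idempotents_star.
  exact: star_up (pv v rv).
(* The criterion asks for agreement arbitrarily near [F]: a member of [B [::]] contains [pt x] for a
   strongly fixed [x], and [(x, 1, x)] is then a triple of both elements. *)
have : agree F s (pt v).
  apply: H; [exact: dom_s|exact: dom_v|move=> V].
  move=> [W oW <-] /= WF0.
  have [|F1 [[uF1 [[x [[gx cx] rx] F1x] _]] WF1]] :=
      clF0 (B [::]) W _ (open_nbhs_nbhs (conj oW WF0)).
    by exists [::].
  have tF1 : tight_filters F1 by exact: subset_closure.
  have F1v : val F1 (pt v).
    by apply: pt_filter_up F1x; [exact: pt_idem|exact: pv].
  exists (exist _ F1 (mem_set tF1)); split; [by []|exact: dom_s|exact: dom_v|].
  apply/agreeP; first exact: dom_s.
  exists (diag x); split=> //; last exact: pv.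
  by have := ups x rx; rewrite gx cx.
move=> /agreeP[|t [st /up_pt[x cx et] Fx]]; first exact: dom_s.
subst t; rewrite sv in cx; rewrite cx cmp_rng in st Fx.
(* Agreement at [F] itself makes [x] strongly fixed with [pt x] in [F], so the neighbourhood of [F0]
   given by [pt x] must meet [B [:: x]], which is absurd. *)
have [gx ax] := up_r (SGLP s) (ups x (esym cx)) st erefl.
have [||F1 [[_ [_ nF1]] F1x]] := clF0 (B [:: x]) (filter_basic (pt x) [::]).
- by exists [:: x] => // y; rewrite inE => /eqP ->.
- apply: open_nbhs_nbhs; split; last by split.
  by apply: open_filter_basic => //; exact: pt_idem.
by apply: (nF1 x); [rewrite mem_head|case: F1x].
Qed.

End SelfSimilarGermGroupoid.

Theorem theorem5p2 (k : nat) (G : groupType) (L : kgraph k)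
    (X : self_similar G L) :
  hausdorff_space (tight_groupoid (SGL X)) <->
  (forall g : G, g <> 1%g -> locally_exhausted (strongly_fixed X g)).
Proof.
by split; [exact: hausdorff_exhausted|exact: exhausted_hausdorff].
Qed.
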